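(* Let $0 < \epsilon < 0.1$, and let $X, H$ be real numbers with $1 \le H \le X^{1/2}$. Then $$2H^2 \sum_{b \le X^{1/4}} \frac{\mu^2(b)}{b^3} \sum_{n \ge 1} S\Bigl( \frac{nH}{b^{3/2}} \Bigr)^2 = H^{2/3} \cdot \frac{4\zeta(4/3)}{3\zeta(2)} \int_0^\infty S(y)^2\, y^{1/3}\, dy + O_\epsilon\Bigl( \frac{H^{1+\epsilon/4}}{X^{1/8}} + H^{2/3-\epsilon/6} \Bigr),$$ where $S(x) = \frac{\sin \pi x}{\pi x}$.
   Context: $\zeta$ is the Riemann zeta function and $\mu$ is the Möbius function. The sums over $b$ and $n$ are over positive integers. $O_\epsilon(g)$ denotes a quantity bounded in absolute value by $C g$ with $C > 0$ depending only on $\epsilon$. *)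

(* Defs.v *)
From HB Require Import structures.
From mathcomp Require Export all_boot all_order all_algebra.
From mathcomp Require Export all_classical all_reals all_analysis.
Export Order.TTheory GRing.Theory Num.Theory.
Export numFieldNormedType.Exports.

Set Implicit Arguments.
Unset Strict Implicit.
Unset Printing Implicit Defensive.

Local Open Scope ring_scope.

(* The value at [n = 0] is irrelevant. *)
Definition mobius (n : nat) : int :=
  if all (fun p => logn p n == 1%N) (primes n) then (-1) ^+ size (primes n)
  else 0.

(* The Riemann zeta function at a real [s > 1], through its Dirichlet series;
   for [s <= 1] the value carries no meaning. *)
Definition zeta (R : realType) (s : R) : R :=
  \big[+%R/0]_(1 <= n <oo) n%:R `^ (- s).

(* Only nonzero arguments matter below; the value [1] at [0] is the
   continuous extension. *)
Definition sinc (R : realType) (x : R) : R :=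
  if x == 0 then 1 else sin (pi * x) / (pi * x).

(* Main.v *)
Require Import Defs.
From mathcomp Require Import zify ring lra.

(** Put [sinpi2 y = (sin (pi y) / pi)^2], so that [sinc y ^ 2 = sinpi2 y / y^2].
With [y = n H / b^(3/2)] the powers of [b] and [H] cancel, and the left-hand
side becomes [2 sum_n n^(-2) Q(n H)], where
[Q(K) = sum_(b <= B) mu(b)^2 sinpi2 (K b^(-3/2))] and [B] is the integer part
of [X^(1/4)].

Without the factor [mu(b)^2], the inner sum is a Riemann sum. The points
[y_m = K m^(-3/2)] cut the half-line into intervals all of which have the same
measure [3/2 K^(-2/3)] for [y^(-5/3) dy], so [2/3 K^(2/3)] times the integral
of [sinpi2 y * y^(-5/3) = sinc y ^ 2 * y^(1/3)] is close to the sum. As [sinpi2]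
is Lipschitz, the error on each interval is at most its length, and these
lengths telescope ([node_sum]). This is used only from [m] about [sqrt K] on;
the at most [sqrt K] earlier terms are bounded by [1] each. What the sum misses
beyond its last term is a piece of the integral near [0], where
[sinpi2 y <= y^(4/5)]. This gives [partial_sum_integral]: for all [K > 0] and
[M >= 0] the sum over [m <= M] is [2/3 K^(2/3) I] up to
[O(K^(1/2) + K^(4/5) (M+1)^(-1/5))], [I] being the integral of the theorem.

Squarefree [b] are selected by [mu(b)^2 = sum_(d^2 | b) mu(d)]. Writing
[b = d^2 m] replaces [K] by [K / d^3], so that [Q(K)] is the sum over
[d <= B] of [mu(d)] times a full sum with parameters [K / d^3] and [B / d^2].
The main terms add up to [2/3 K^(2/3) I sum_(d <= B) mu(d) / d^2], which
produces [1 / zeta 2], and the error terms still converge in [d]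
([squarefree_sum_zeta]). It matters here that the Riemann sum estimate holds
for small [K] too.

The choice [K = n H], the weight [n^(-2)] and the sum over [n] produce
[zeta (4/3)] and the errors [H^(1/2)], [H^(4/5) B^(-1/5)] and
[H^(2/3) B^(-1/2)], the last from cutting the series for [1 / zeta 2]. The first
is at most [H^(2/3 - eps/6)] and the third at most the second. The second is,
up to the rounding of [X^(1/4)], the weighted geometric mean of the two error
terms of the theorem with weights [2/5] and [3/5] ([error_interpolation]); this
dictates the exponent [4/5] in the bound for [sinpi2] near [0]. The sum over [n]
is handled through its partial sums, on which all estimates are uniform. *)

Local Open Scope classical_set_scope.
Local Open Scope ring_scope.

(** * Squares and the Moebius function *)

Lemma sum_multiples {V : nmodType} (g : nat -> V) (k N : nat) : (0 < k)%N ->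
  \sum_(1 <= n < N.+1 | (k %| n)%N) g n =
  \sum_(1 <= m < (N %/ k).+1) g (k * m)%N.
Proof.
move=> k0; elim: N => [|N IH]; first by rewrite div0n !big_geq.
rewrite big_mkcond big_nat_recr //= -big_mkcond IH divnS //.
case: ifPn => [kN|_]; last by rewrite add0n addr0.
rewrite add1n [RHS]big_nat_recr //=; congr (_ + g _).
by rewrite -[LHS](divnK kN) divnS // kN add1n mulnC.
Qed.

(** The square of [p] divides [p * m]. *)
Lemma mobius_mul_dvd (p m : nat) : prime p -> (0 < m)%N -> (p %| m)%N ->
  mobius (p * m) = 0.
Proof.
move=> pp m0 pm; rewrite /mobius; case: ifPn => // /allP /(_ p).
have p0 := prime_gt0 pp.
rewrite mem_primes pp muln_gt0 p0 m0 dvdn_mulr // => /(_ erefl).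
by rewrite lognM // logn_prime // eqxx eqSS -leqn0 leqNgt logn_gt0 mem_primes pp m0 pm.
Qed.

Lemma mobius_mul_ndvd (p m : nat) : prime p -> (0 < m)%N -> ~~ (p %| m)%N ->
  mobius (p * m) = - mobius m.
Proof.
move=> pp m0 pm; have p0 := prime_gt0 pp.
have pmP : p \notin primes m by rewrite mem_primes pp m0.
have perm_primes : perm_eq (primes (p * m)) (p :: primes m).
  apply: uniq_perm; rewrite ?primes_uniq //= ?pmP ?primes_uniq // => q.
  by rewrite primesM // inE primes_prime // inE.
rewrite /mobius (perm_all _ perm_primes) (perm_size perm_primes) /=.
rewrite lognM // logn_prime // eqxx.
have -> : logn p m = 0%N by apply/eqP; rewrite -leqn0 leqNgt logn_gt0.
rewrite andTb; have -> : all (fun q => logn q (p * m) == 1%N) (primes m) =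
    all (fun q => logn q m == 1%N) (primes m).
  apply: eq_in_all => q qm; have -> : logn q (p * m) = logn q m; last by [].
  rewrite lognM // logn_prime // eq_sym; case: eqP => // pq.
  by rewrite -pq (negbTE pmP) in qm.
by case: ifP => _; rewrite ?oppr0 // exprS mulN1r.
Qed.

(** Fix a prime [p] dividing [n]. The divisors [m] prime to [p] cancel against
the divisors [p * m], and the divisors divisible by [p^2] contribute nothing.
The sum runs up to an arbitrary [N >= n] so that it can be used with a bound
independent of [n]. *)
Lemma sum_mobius_divisors (n N : nat) : (0 < n <= N)%N ->
  \sum_(1 <= d < N.+1 | (d %| n)%N) mobius d = (n == 1%N)%:R.
Proof.
move=> /andP[n0 nN].
have [->|n1] := eqVneq n 1%N.
  rewrite -(subnKC (leq_trans n0 nN)) big_mkcond /= big_nat_recl // big1_seq ?addr0 // => d /=.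
  rewrite mem_index_iota dvdn1 => /andP[d1 _].
  by rewrite gtn_eqF.
set p := pdiv n.
have pp : prime p by apply: pdiv_prime; rewrite ltn_neqAle eq_sym n1.
have p0 := prime_gt0 pp; have pn : (p %| n)%N := pdiv_dvd n.
rewrite (bigID (fun d => p %| d)%N) /=.
rewrite [X in X + _]big_mkcondl /= sum_multiples // /=.
rewrite (@big_nat_widen _ _ _ 1 (N %/ p).+1 N.+1) /=; last first.
  by rewrite ltnS leq_div.
rewrite [X in X + _]big_mkcond [X in _ + X]big_mkcond -big_split big1_seq //= => m.
rewrite mem_index_iota => /andP[m0 mN].
(* Both sums are now over [m]: the left one comes from the divisors [p * m]. *)
have [pm|pm] := boolP (p %| m)%N; rewrite ?andbF ?andbT /=.
  by rewrite addr0 mobius_mul_dvd // !if_same.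
have cpm : coprime p m by rewrite prime_coprime.
rewrite Gauss_dvd // pn /=.
have [mn|mn] := boolP (m %| n)%N; last by rewrite if_same addr0.
have -> : (m < (N %/ p).+1)%N.
  rewrite ltnS leq_divRL // mulnC; apply: leq_trans nN; apply: dvdn_leq => //.
  by rewrite Gauss_dvd // pn.
by rewrite mobius_mul_ndvd // addNr.
Qed.

(** Take [a] largest with [a ^ 2] dividing [b]: if [d ^ 2] divides [b] as well,
so does the square of the least common multiple of [a] and [d], which
therefore cannot exceed [a]. *)
Lemma sqr_dvd_root (b : nat) : (0 < b)%N ->
  exists2 a, (0 < a)%N & forall d, (d ^ 2 %| b)%N = (d %| a)%N.
Proof.
move=> b0.
have ex : exists a, (a ^ 2 %| b)%N by exists 1%N; rewrite dvd1n.
have bd a : (a ^ 2 %| b)%N -> (a <= b)%N.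
  move=> /dvdn_leq -/(_ b0); apply: leq_trans.
  by case: a => // a; rewrite -{1}(expn1 a.+1) leq_pexp2l.
case: (ex_maxnP ex bd) => a ab amax.
have a0 : (0 < a)%N by apply: amax; rewrite dvd1n.
exists a => // d; apply/idP/idP => [db|da]; last first.
  exact: dvdn_trans (dvdn_exp2r 2 da) ab.
have d0 : (0 < d)%N by rewrite lt0n; apply: contraTneq db => ->; rewrite dvd0n gtn_eqF.
have g0 : (0 < gcdn d a)%N by rewrite gcdn_gt0 d0.
have [d' def_d] := dvdnP (dvdn_gcdl d a).
have [a' def_a] := dvdnP (dvdn_gcdr d a).
set g := gcdn d a in g0 def_d def_a.
have cda : coprime d' a'.
  rewrite /coprime -(eqn_pmul2r g0) mul1n muln_gcdl -def_d -def_a.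
  by rewrite -/g.
have [c def_b] := dvdnP (dvdn_trans (dvdn_exp2r 2 (dvdn_gcdl d a)) db).
have g20 : (0 < g ^ 2)%N by rewrite expn_gt0 g0.
have lb : ((d' * a) ^ 2 %| b)%N.
  rewrite def_a mulnA expnMn def_b -/g dvdn_pmul2r // expnMn Gauss_dvd ?coprimeXl ?coprimeXr //.
  have dvd_div e : (e ^ 2 %| c)%N = ((e * g) ^ 2 %| b)%N.
    by rewrite def_b expnMn dvdn_pmul2r.
  by rewrite !dvd_div -def_d -def_a db.
have := amax _ lb; rewrite -{2}(mul1n a) leq_pmul2r // => d'1.
rewrite def_d (_ : d' = 1%N) ?mul1n ?dvdn_gcdr //.
apply/eqP; rewrite eqn_leq d'1 lt0n.
by apply: contraTneq d0 => d'0; rewrite def_d d'0.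
Qed.

(** [a = 1] means that [b] is squarefree. *)
Lemma mobius_sqr (b a : nat) : (0 < b)%N -> (0 < a)%N ->
  (forall d, (d ^ 2 %| b)%N = (d %| a)%N) ->
  mobius b ^+ 2 = (a == 1%N)%:R.
Proof.
move=> b0 a0 ha; rewrite /mobius; have [a1|a1] := eqVneq a 1%N.
  rewrite ifT ?sqrr_sign //; apply/allP => p pb.
  move: (pb); rewrite mem_primes => /and3P[pp _ _].
  rewrite eqn_leq logn_gt0 pb andbT leqNgt -pfactor_dvdn // ha a1.
  by rewrite dvdn1 eq_sym ltn_eqF ?prime_gt1.
rewrite ifN ?expr0n //; apply/allPn.
set p := pdiv a; have pp : prime p by apply: pdiv_prime; rewrite ltn_neqAle eq_sym a1.
have : (p ^ 2 %| b)%N by rewrite ha pdiv_dvd.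
rewrite pfactor_dvdn // => lp; exists p; last by rewrite gtn_eqF.
by rewrite -logn_gt0; apply: leq_trans lp.
Qed.

(** By [sqr_dvd_root] the condition on [d] is divisibility of a fixed [a], and
the sum detects whether [a = 1], that is, whether [b] is squarefree. *)
Lemma sum_mobius_square_divisors (b N : nat) : (0 < b <= N)%N ->
  \sum_(1 <= d < N.+1 | (d ^ 2 %| b)%N) mobius d = mobius b ^+ 2.
Proof.
move=> /andP[b0 bN]; have [a a0 ha] := sqr_dvd_root _ b0.
rewrite (mobius_sqr _ _ b0 a0 ha) -(sum_mobius_divisors a N).
  by apply: eq_bigl => d; rewrite ha.
rewrite a0 /=; apply: leq_trans bN; apply: dvdn_leq => //.
by apply: dvdn_trans (_ : a ^ 2 %| b)%N; rewrite ?ha // -mulnn dvdn_mulr.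
Qed.

(** Used with [k = 1] to invert [zeta 2] and with [k = 2] to select squarefree
integers. *)
Lemma sum_mobius_interchange {R : pzRingType} (g : nat -> R) (k N : nat) : (0 < k)%N ->
  \sum_(1 <= n < N.+1) (\sum_(1 <= d < N.+1 | (d ^ k %| n)%N) mobius d)%:~R * g n =
  \sum_(1 <= d < N.+1) (mobius d)%:~R * \sum_(1 <= m < (N %/ d ^ k).+1) g (d ^ k * m)%N.
Proof.
move=> k0.
under eq_bigr => n _ do rewrite rmorph_sum /= mulr_suml big_mkcond.
rewrite exchange_big_nat /=; apply: eq_big_nat => d /andP[d0 _].
rewrite -big_mkcond -mulr_sumr; congr (_ * _).
by rewrite sum_multiples // expn_gt0 d0.
Qed.

(** * Power sums and the zeta function *)

Lemma powR_exp {R : realType} (x r : R) : 0 < x -> x `^ r = expR (r * ln x).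
Proof. by move=> x0; rewrite /powR gt_eqF. Qed.

Lemma powRDp {R : realType} (x r s : R) : 0 < x -> x `^ (r + s) = x `^ r * x `^ s.
Proof. by move=> x0; rewrite powRD // (gt_eqF x0) implybT. Qed.

Lemma ler_powRn {R : realType} (x y r : R) : 0 < x -> x <= y -> r <= 0 ->
  y `^ r <= x `^ r.
Proof.
move=> x0 xy r0; have y0 := lt_le_trans x0 xy.
by rewrite !powR_exp // ler_expR ler_wnM2l // ler_ln.
Qed.

(** Dividing by [(n + 1)^(-t)] turns this into
[1 + t / (n + 1) <= ((n + 1) / n)^t], which follows from [1 + x <= exp x] and
[ln (n / (n + 1)) <= - 1 / (n + 1)]. *)
Lemma powR_telescope {R : realType} (t : R) (n : nat) : 0 < t -> (0 < n)%N ->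
  n.+1%:R `^ (- (1 + t)) <= (n%:R `^ (- t) - n.+1%:R `^ (- t)) / t.
Proof.
move=> t0 n0.
have a0 : 0 < n%:R :> R by rewrite ltr0n.
have b0 : 0 < n.+1%:R :> R by rewrite ltr0n.
set a : R := n%:R in a0 *; have def_b : n.+1%:R = a + 1 :> R by rewrite /a -natr1.
rewrite def_b in b0 *.
rewrite ler_pdivlMr // lerBrDr opprD powRDp // (powR_inv1 (ltW b0)).
have -> : a `^ (- t) = (a + 1) `^ (- t) * expR (t * - ln (a / (a + 1))).
  rewrite !powR_exp // -expRD ln_div ?posrE //; congr expR; lra.
rewrite -[X in _ * _ * t + X]mulr1 mulrAC [_^-1 * t]mulrC [X in X + _]mulrC.
rewrite -mulrDr ler_pM2l ?powR_gt0 //.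
apply: le_trans (expR_ge1Dx _); rewrite addrC lerD2l; apply: ler_pM => //.
- exact: ltW.
- by rewrite invr_ge0 ltW.
have -> : a / (a + 1) = 1 + - (a + 1)^-1 by field; rewrite gt_eqF.
rewrite lerNr; apply: le_ln1Dx; rewrite ltrN2 invf_lt1 //; lra.
Qed.

Lemma sum_powR_tail {R : realType} (t : R) (m n : nat) : 0 < t -> (0 < m)%N ->
  \sum_(m.+1 <= k < n) k%:R `^ (- (1 + t)) <= m%:R `^ (- t) / t.
Proof.
move=> t0 m0; have [nm|mn] := leqP n m.+1.
  by rewrite big_geq // divr_ge0 ?powR_ge0 // ltW.
have mn' : (m <= n.-1)%N by rewrite -ltnS (ltn_predK mn) ltnW.
rewrite -(ltn_predK mn) big_add1 /=.
apply: (@le_trans _ _ (\sum_(m <= k < n.-1)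
    ((- (k.+1%:R `^ (- t) / t)) - (- (k%:R `^ (- t) / t))))).
  apply: ler_sum_nat => k /andP[mk _].
  rewrite opprK [X in _ <= X]addrC -mulrBl.
  by apply: powR_telescope => //; exact: leq_trans mk.
rewrite telescope_sumr // opprK gerDr oppr_le0 divr_ge0 ?powR_ge0 //.
exact: ltW.
Qed.

Lemma sum_powR_le {R : realType} (t : R) (n : nat) : 0 < t ->
  \sum_(1 <= k < n) k%:R `^ (- (1 + t)) <= 1 + t^-1.
Proof.
move=> t0; have [n1|n1] := leqP n 1.
  by rewrite big_geq // addr_ge0 // invr_ge0 ltW.
rewrite big_ltn // powR1; rewrite lerD2l.
by have := sum_powR_tail _ 1 n t0 isT; rewrite powR1 mul1r.
Qed.

Lemma zeta_cvg {R : realType} (s : R) : 1 < s ->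
  (fun n => \sum_(1 <= k < n) k%:R `^ (- s)) @ \oo --> zeta s.
Proof.
move=> s1; apply: nondecreasing_is_cvgn.
  apply/nondecreasing_seqP => n; case: n => [|n]; first by rewrite !big_geq.
  by rewrite [X in _ <= X]big_nat_recr //= lerDl powR_ge0.
exists (1 + (s - 1)^-1) => _ [n _ <-].
have := @sum_powR_le _ (s - 1) n; rewrite subrKC => -> //; lra.
Qed.

Lemma zeta_partial_sum_le {R : realType} (s : R) (n : nat) : 1 < s ->
  \sum_(1 <= k < n) k%:R `^ (- s) <= zeta s.
Proof.
move=> s1; have /cvg_lim <- // := zeta_cvg _ s1.
apply: nondecreasing_cvgn_le; last by apply/cvg_ex; exists (zeta s); exact: zeta_cvg.
apply/nondecreasing_seqP => m; case: m => [|m]; first by rewrite !big_geq.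
by rewrite [X in _ <= X]big_nat_recr //= lerDl powR_ge0.
Qed.

Lemma zeta_ge1 {R : realType} (s : R) : 1 < s -> 1 <= zeta s.
Proof.
move=> s1; have := zeta_partial_sum_le _ 2 s1.
by rewrite big_nat1 powR1.
Qed.

Lemma zeta_le_near {R : realType} (s M : R) (m : nat) : 1 < s ->
  (forall n, (m < n)%N -> \sum_(1 <= k < n) k%:R `^ (- s) <= M) -> zeta s <= M.
Proof.
move=> s1 hM; have /cvg_lim <- // := zeta_cvg _ s1.
apply: limr_le; first by apply/cvg_ex; exists (zeta s); exact: zeta_cvg.
by near=> n; apply: hM; near: n; exact: nbhs_infty_gt.
Unshelve. all: by end_near. Qed.

Lemma powR_half_natS {R : realType} (m : nat) : (0 < m)%N ->
  m%:R^-1 <= 2 * m.+1%:R `^ (- (1 / 2)) :> R.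
Proof.
move=> m0; have M0 : 0 < m.+1%:R :> R by rewrite ltr0n.
apply: (@le_trans _ _ (2 * m.+1%:R^-1)).
  by rewrite ler_pdivlMr // mulrC ler_pdivrMr ?ltr0n // -natrM ler_nat; lia.
rewrite ler_pM2l // -(powR_inv1 (ltW M0)) !powR_exp // ler_expR ler_wpM2r //; last lra.
by rewrite ln_ge0 // ler1n.
Qed.

(** The tail of [zeta 2] after [m] terms is of order [1 / m]; half of this
decay is given up to obtain a bound that also makes sense for [m = 0] and whose
sum over divisors converges without a logarithm. *)
Lemma zeta2_tail {R : realType} (m : nat) :
  zeta 2 - \sum_(1 <= k < m.+1) k%:R `^ (- 2) <= 2 * m.+1%:R `^ (- (1 / 2)) :> R.
Proof.
rewrite lerBlDr; apply: (zeta_le_near _ _ m); first lra.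
move=> n mn; rewrite (@big_cat_nat _ _ _ m.+1) //= addrC lerD2r.
case: m mn => [|m] mn.
  by rewrite powR1 mulr1; have := @sum_powR_le R 1 n ltr01; rewrite invr1 => /le_trans -> //; lra.
apply: le_trans (powR_half_natS _ _) => //.
have := @sum_powR_tail R 1 m.+1 n ltr01 isT.
by rewrite divr1 powR_inv1.
Qed.

Lemma norm_mobius {R : realType} (n : nat) : `|(mobius n)%:~R| <= 1 :> R.
Proof.
rewrite /mobius; case: ifP => _; last by rewrite normr0.
by rewrite rmorphXn /= rmorphN1 normrX normrN1 expr1n.
Qed.

(** If each inner sum over [m <= n / d] in the interchange lemma were replaced
by [zeta 2], the total would be [S * zeta 2], with [S] the sum on the left. The
true total is [1], and the replacement costs the tails of [zeta 2], which are
small on average over [d]. *)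
Lemma sum_mobius_inv_sqr {R : realType} (n : nat) : (0 < n)%N ->
  `| \sum_(1 <= d < n.+1) (mobius d)%:~R * d%:R `^ (- 2) - (zeta 2)^-1 | <=
  6 * n.+1%:R `^ (- (1 / 2)) :> R.
Proof.
move=> n0; set S := \sum_(_ <= _ < _) _.
have z1 : 1 <= zeta 2 :> R by apply: zeta_ge1; lra.
have z0 : 0 < zeta 2 :> R by apply: lt_le_trans z1.
have key : \sum_(1 <= d < n.+1) (mobius d)%:~R * (d%:R `^ (- 2) *
    \sum_(1 <= m < (n %/ d).+1) m%:R `^ (- 2)) = 1 :> R.
  have := sum_mobius_interchange (fun k => k%:R `^ (- 2) : R) 1 n isT.
  under eq_big_nat => k /andP[k0 kn].
    under eq_bigl => d do rewrite expn1.
    rewrite sum_mobius_divisors ?k0 //. over.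
  rewrite big_ltn // big1_seq => [|k].
    rewrite eqxx powR1 mulr1 addr0 /= mulr1z => e; rewrite [RHS]e.
    apply: eq_bigr => d _; rewrite expn1; congr (_ * _).
    rewrite mulr_sumr; apply: eq_bigr => m _.
    by rewrite natrM powRM.
  by rewrite /= mem_index_iota => /andP[k2 _]; rewrite gtn_eqF // mul0r.
have -> : S - (zeta 2)^-1 = (zeta 2)^-1 * (S * zeta 2 - 1).
  by rewrite mulrBr mulr1 mulrCA mulVf ?mulr1 // gt_eqF.
rewrite normrM gtr0_norm ?invr_gt0 //.
apply: (@le_trans _ _ (1 * `|S * zeta 2 - 1|)).
  by rewrite ler_wpM2r // invf_le1.
rewrite mul1r -[X in _ - X]key /S mulr_suml -sumrB.
apply: le_trans (ler_norm_sum _ _ _) _.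
apply: (@le_trans _ _ (\sum_(1 <= d < n.+1) 2 * n.+1%:R `^ (- (1 / 2)) * d%:R `^ (- (1 + 1 / 2)))).
  apply: ler_sum_nat => d /andP[d0 dn].
  have D0 : 0 < d%:R :> R by rewrite ltr0n.
  rewrite -mulrA -!mulrBr !normrM -[leRHS]mul1r; apply: ler_pM => //.
    exact: norm_mobius.
  rewrite ger0_norm ?powR_ge0 // ger0_norm; last first.
    by rewrite subr_ge0 zeta_partial_sum_le //; lra.
  have le1 : (n.+1%:R / d%:R) <= (n %/ d).+1%:R :> R.
    by rewrite ler_pdivrMr // -natrM ler_nat ltn_ceil.
  apply: (@le_trans _ _ (d%:R `^ (- 2) * (2 * (n.+1%:R / d%:R) `^ (- (1 / 2))))).
    rewrite ler_wpM2l ?powR_ge0 //; apply: le_trans (zeta2_tail _) _.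
    rewrite ler_pM2l // ler_powRn //; first by rewrite divr_gt0 // ltr0n.
  rewrite -[d%:R^-1]powR_inv1 ?ler0n // powRM ?powR_ge0 // -powRrM.
  rewrite mulrCA -[leRHS]mulrA ler_pM2l // mulrCA ler_wpM2l ?powR_ge0 // -powRDp //.
  by rewrite (_ : - 2 + _ = - (1 + 1 / 2)) //; lra.
rewrite -mulr_sumr (_ : 6 * _ = 2 * n.+1%:R `^ (- (1 / 2)) * 3); last by lra.
rewrite ler_wpM2l ?mulr_ge0 ?powR_ge0 //.
apply: le_trans (sum_powR_le _ _ _) _; first lra.
by rewrite le_eqVlt (_ : 1 + (1 / 2)^-1 = 3) ?eqxx //; field.
Qed.

(** * The squared sine and power integrals *)

Lemma norm_sin_le {R : realType} (x : R) : `|sin x| <= `|x|.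
Proof.
wlog x0 : x / 0 <= x.
  move=> hw; have [/hw //|/ltW x0] := leP 0 x.
  by rewrite -normrN -sinN -[leRHS]normrN hw // oppr_ge0.
have dsin t : t \in `]0, x[ -> is_derive t 1 sin (cos t) by move=> _; exact: is_derive_sin.
have csin : {within `[0, x], continuous (@sin R)}.
  by apply: continuous_subspaceT => t; exact: continuous_sin.
have [c _] := MVT_segment x0 dsin csin.
rewrite sin0 !subr0 => ->; rewrite normrM ler_piMl //.
exact: cos_max.
Qed.

Definition sinpi2 {R : realType} (t : R) : R := (sin (pi * t) / pi) ^+ 2.

Lemma sinpi2_ge0 {R : realType} (t : R) : 0 <= sinpi2 t.
Proof. exact: sqr_ge0. Qed.

Lemma pi_ge1 {R : realType} : 1 <= pi :> R.
Proof. by apply: le_trans (pi_ge2 _); lra. Qed.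

Lemma sinpi2_le1 {R : realType} (t : R) : sinpi2 t <= 1.
Proof.
have p1 := @pi_ge1 R; have p0 : 0 < pi :> R by lra.
rewrite /sinpi2 -real_normK ?num_real // expr_le1 ?normr_ge0 // normrM normfV.
rewrite (gtr0_norm p0) ler_pdivrMr // mul1r.
exact: le_trans (sin_max _) _.
Qed.

Lemma sinpi2_le_sqr {R : realType} (t : R) : sinpi2 t <= t ^+ 2.
Proof.
have p1 := @pi_ge1 R; have p0 : 0 < pi :> R by lra.
rewrite /sinpi2 -[leLHS]real_normK ?num_real // -[leRHS]real_normK ?num_real // lerXn2r ?nnegrE ?normr_ge0 //.
rewrite normrM normfV (gtr0_norm p0) ler_pdivrMr //.
by apply: le_trans (norm_sin_le _) _; rewrite normrM (gtr0_norm p0) mulrC.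
Qed.

(** From [sin^2 a - sin^2 b = sin (a - b) sin (a + b)]. *)
Lemma sinpi2_lipschitz {R : realType} (s t : R) : `|sinpi2 s - sinpi2 t| <= `|s - t|.
Proof.
have p1 := @pi_ge1 R; have p0 : 0 < pi :> R by lra.
have -> : sinpi2 s - sinpi2 t =
    sin (pi * s - pi * t) * sin (pi * s + pi * t) / pi ^+ 2.
  rewrite /sinpi2 sinB sinD !exprMn exprVn -mulrBl; congr (_ / _).
  have := cos2Dsin2 (pi * s); have := cos2Dsin2 (pi * t).
  set a := sin _; set b := cos _; set c := cos _; set d := sin _ => h1 h2.
  nra.
rewrite !normrM normfV (gtr0_norm (exprn_gt0 _ p0)) ler_pdivrMr ?exprn_gt0 //.
rewrite -mulrBr.
have h1 : `|sin (pi * (s - t))| <= pi * `|s - t|.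
  by apply: le_trans (norm_sin_le _) _; rewrite normrM (gtr0_norm p0).
have h2 := sin_max (pi * s + pi * t).
apply: (@le_trans _ _ (pi * `|s - t| * 1)); first exact: ler_pM.
by rewrite mulr1 [leRHS]mulrC ler_wpM2r // expr2 ler_peMl // ltW.
Qed.

(** Interpolates between the bounds [1] and [t ^ 2]. *)
Lemma sinpi2_le_powR {R : realType} (r t : R) : 0 <= r <= 2 -> 0 < t ->
  sinpi2 t <= t `^ r.
Proof.
move=> /andP[r0 r2] t0; have [t1|/ltW t1] := leP 1 t.
  apply: le_trans (sinpi2_le1 _) _.
  by rewrite -(powRr0 t) ler_powR.
apply: le_trans (sinpi2_le_sqr _) _.
by rewrite -powR_mulrn ?(ltW t0) // ger_powR // t0.
Qed.

Lemma sinpi2_continuous {R : realType} : continuous (@sinpi2 R).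
Proof.
move=> t; apply: (@continuous_comp _ _ _ (fun t : R => sin (pi * t) / pi) (fun x => x ^+ 2)); last exact: exprn_continuous.
apply: cvgM; last exact: cvg_cst.
apply: (@continuous_comp _ _ _ (fun t : R => pi * t) sin); last exact: continuous_sin.
by apply: cvgM; [exact: cvg_cst|exact: cvg_id].
Qed.

Section positive_half_line.
Context {R : realType}.
Notation mu := (@lebesgue_measure R).

Lemma powR_continuous (r t : R) : 0 < t -> {for t, continuous (fun x : R => x `^ r)}.
Proof.
move=> t0; apply/differentiable_continuous/derivable1_diffP.
by apply: derivable_powR; rewrite in_itv /= andbT.
Qed.

Lemma within_itv_continuous (f : R -> R) (a b : R) : 0 < a ->
  (forall t, 0 < t -> {for t, continuous f}) -> {within `[a, b], continuous f}.
Proof.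
move=> a0 cf; apply: continuous_in_subspaceT => t.
rewrite inE /= in_itv /= => /andP[at_ _]; apply: cf.
exact: lt_le_trans at_.
Qed.

Lemma itv_integrable (f : R -> R) (a b : R) : 0 < a ->
  (forall t, 0 < t -> {for t, continuous f}) -> mu.-integrable `[a, b] (EFin \o f).
Proof.
move=> a0 cf; apply: continuous_compact_integrable; first exact: segment_compact.
exact: within_itv_continuous.
Qed.

Lemma Rintegral_powR (a b r : R) : 0 < a -> a <= b -> r != 0 ->
  \int[mu]_(t in `[a, b]) (t `^ (r - 1)) = (b `^ r - a `^ r) / r.
Proof.
move=> a0; rewrite le_eqVlt => /predU1P[<- _|ab r0].
  by rewrite subrr mul0r set_itv1 Rintegral_set1.
rewrite /Rintegral (@continuous_FTC2 R _ (fun t => t `^ r / r)) //=.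
- by rewrite mulrBl.
- by apply: within_itv_continuous => // t; exact: powR_continuous.
- have cF t : 0 < t -> {for t, continuous (fun t : R => t `^ r / r)}.
    by move=> t0; apply: cvgM; [exact: powR_continuous|exact: cvg_cst].
  split.
  + move=> t; rewrite in_itv /= => /andP[at_ _]; apply: derivableM => //.
    apply: derivable_powR; rewrite in_itv /= andbT; exact: lt_trans at_.
  + by apply: cvg_at_right_filter; exact: cF.
  + by apply: cvg_at_left_filter; apply: cF; exact: lt_trans ab.
- move=> t; rewrite in_itv /= => /andP[at_ _].
  have t0 : 0 < t by exact: lt_trans at_.
  rewrite derive1Mr ?powR_derive1 ?in_itv /= ?andbT // 1?mulrC ?mulKf //.
  by apply: derivable_powR; rewrite in_itv /= andbT.
Qed.

End positive_half_line.

(** * The mass of the density on intervals *)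

Section sinpi2_integral.
Context {R : realType}.
Notation mu := (@lebesgue_measure R).

(** On the positive half-line this is [sinc t ^ 2 * t^(1/3)], in the form in
which the Riemann sum is compared with an integral of [t^(-5/3)]. *)
Definition density (t : R) : R := sinpi2 t * t `^ (- (5 / 3)).

Definition mass (a b : R) : R := \int[mu]_(t in `[a, b]) density t.

Lemma density_ge0 (t : R) : 0 <= density t.
Proof. by rewrite mulr_ge0 ?sinpi2_ge0 ?powR_ge0. Qed.

Lemma density_continuous (t : R) : 0 < t -> {for t, continuous density}.
Proof.
by move=> t0; apply: cvgM; [exact: sinpi2_continuous|exact: powR_continuous].
Qed.

Lemma density_le (r t : R) : 0 <= r <= 2 -> 0 < t ->
  density t <= t `^ (r - 2 / 3 - 1).
Proof.
move=> r02 t0; rewrite (_ : r - 2 / 3 - 1 = r + - (5 / 3)); last lra.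
by rewrite powRDp // ler_wpM2r ?powR_ge0 // sinpi2_le_powR.
Qed.

Let scaled_powR_continuous (c r t : R) : 0 < t ->
  {for t, continuous (fun t : R => c * t `^ r)}.
Proof. by move=> t0; apply: cvgM; [exact: cvg_cst|exact: powR_continuous]. Qed.

(** Together with [le_mass], the source of all bounds on integrals below: an
integrand between two multiples of a power has its integral between the
corresponding increments of a primitive. *)
Lemma mass_le (a b r c : R) : 0 < a -> a <= b -> r != 0 ->
  (forall t, a <= t <= b -> density t <= c * t `^ (r - 1)) ->
  mass a b <= c * ((b `^ r - a `^ r) / r).
Proof.
move=> a0 ab r0 h; rewrite -Rintegral_powR // -RintegralZl //; last first.
  by apply: itv_integrable => // t; exact: powR_continuous.
apply: le_Rintegral => //.
- by apply: itv_integrable => // t; exact: density_continuous.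
- by apply: itv_integrable => // t t0; exact: scaled_powR_continuous.
Qed.

Lemma le_mass (a b r c : R) : 0 < a -> a <= b -> r != 0 ->
  (forall t, a <= t <= b -> c * t `^ (r - 1) <= density t) ->
  c * ((b `^ r - a `^ r) / r) <= mass a b.
Proof.
move=> a0 ab r0 h; rewrite -Rintegral_powR // -RintegralZl //; last first.
  by apply: itv_integrable => // t; exact: powR_continuous.
apply: le_Rintegral => //.
- by apply: itv_integrable => // t t0; exact: scaled_powR_continuous.
- by apply: itv_integrable => // t; exact: density_continuous.
Qed.

Lemma mass_ge0 (a b : R) : 0 <= mass a b.
Proof. by apply: Rintegral_ge0 => t _; exact: density_ge0. Qed.

Lemma mass_cat (a b c : R) : 0 < a -> a <= b -> b <= c ->
  mass a c = mass a b + mass b c.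
Proof.
move=> a0 ab bc; apply/eqP; rewrite addrC -subr_eq; apply/eqP.
have int_ac : mu.-integrable `[a, c] (EFin \o density).
  by apply: itv_integrable => // t; exact: density_continuous.
rewrite /mass Rintegral_itvB ?bnd_simp //.
rewrite Rintegral_itv_obnd_cbnd //.
by apply: integrableS int_ac => //; apply: subset_itv; rewrite bnd_simp.
Qed.

(** [density t <= t^(4/5 - 5/3) = t^(2/15 - 1)]. *)
Lemma mass_head (a b : R) : 0 < a -> a <= b -> mass a b <= 15 / 2 * b `^ (2 / 15).
Proof.
move=> a0 ab; apply: le_trans (mass_le _ _ (2 / 15) 1 a0 ab _ _) _.
- by rewrite gt_eqF //; lra.
- move=> t /andP[at_ _]; rewrite mul1r.
  have := density_le (4 / 5) _ _ (lt_le_trans a0 at_).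
  by rewrite (_ : 4 / 5 - 2 / 3 - 1 = 2 / 15 - 1); [apply; lra|lra].
- by have := powR_ge0 a (2 / 15); lra.
Qed.

(** [density t <= t^(- 5/3)]. *)
Lemma mass_tail (a b : R) : 0 < a -> a <= b -> mass a b <= 3 / 2 * a `^ (- (2 / 3)).
Proof.
move=> a0 ab; apply: le_trans (mass_le _ _ (- (2 / 3)) 1 a0 ab _ _) _.
- by rewrite lt_eqF //; lra.
- move=> t /andP[at_ _]; rewrite mul1r.
  have := density_le 0 _ _ (lt_le_trans a0 at_).
  by rewrite sub0r; apply; lra.
- by have := powR_ge0 b (- (2 / 3)); rewrite invrN; lra.
Qed.

Lemma mass_bounded (a b : R) : 0 < a -> a <= 1 -> 1 <= b -> mass a b <= 9.
Proof.
move=> a0 a1 b1; rewrite (mass_cat _ 1) //.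
have := mass_head _ _ a0 a1; have := mass_tail _ _ ltr01 b1.
by rewrite !powR1; lra.
Qed.

(** The middle factor is the integral of [u^(- 5/3)] over the interval, on
which [sinpi2] stays within [t - s] of its value at [t]. *)
Lemma mass_step (s t : R) : 0 < s -> s <= t ->
  `| mass s t - sinpi2 t * (3 / 2 * (s `^ (- (2 / 3)) - t `^ (- (2 / 3)))) | <=
  (t - s) * (3 / 2 * (s `^ (- (2 / 3)) - t `^ (- (2 / 3)))).
Proof.
move=> s0 st.
have -> : 3 / 2 * (s `^ (- (2 / 3)) - t `^ (- (2 / 3))) =
   (t `^ (- (2 / 3)) - s `^ (- (2 / 3))) / - (2 / 3) by rewrite invrN; field.
set P := _ / - (2 / 3).
have expE : - (2 / 3) - 1 = - (5 / 3) :> R by lra.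
have r0 : - (2 / 3) != 0 :> R by rewrite lt_eqF //; lra.
have lip u : s <= u <= t -> `|sinpi2 u - sinpi2 t| <= t - s.
  move=> /andP[su ut]; apply: le_trans (sinpi2_lipschitz _ _) _.
  by rewrite distrC ger0_norm ?subr_ge0 // lerB.
have ub : mass s t <= (sinpi2 t + (t - s)) * P.
  apply: mass_le => // u stu; rewrite expE ler_wpM2r ?powR_ge0 //.
  by rewrite -lerBlDl; exact: le_trans (ler_norm _) (lip _ stu).
have lb : (sinpi2 t - (t - s)) * P <= mass s t.
  apply: le_mass => // u stu; rewrite expE ler_wpM2r ?powR_ge0 //.
  have := lip _ stu; rewrite ler_norml => /andP[]; lra.
by rewrite ler_norml; apply/andP; split; lra.
Qed.

(** The improper integral enters the estimates only through this limit, so that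
they can all be made on compact intervals away from [0]. *)
Lemma mass_cvg : (fun k => mass k.+1%:R^-1 k.+1%:R) @ \oo -->
  \int[mu]_(y in `]0, +oo[) (sinc y ^+ 2 * y `^ (1 / 3)).
Proof.
have -> : \int[mu]_(y in `]0, +oo[) (sinc y ^+ 2 * y `^ (1 / 3)) =
    \int[mu]_(y in `]0, +oo[) density y.
  apply: eq_Rintegral => y; rewrite inE /= in_itv /= andbT => y0.
  have -> : density y = sinpi2 y * (y^-1 ^+ 2 * y `^ (1 / 3)).
    by rewrite exprVn -(powR_invn 2 (ltW y0)) -powRDp // /density; congr (_ * _ `^ _); lra.
  by rewrite /sinc gt_eqF // /sinpi2 invfM; ring.
pose F k := `[k.+1%:R^-1 : R, k.+1%:R]%classic.
have F_pos k t : F k t -> 0 < t.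
  rewrite /F /= in_itv /= => /andP[kt _]; apply: lt_le_trans kt.
  by rewrite invr_gt0 ltr0n.
have bigF : \bigcup_k F k = `]0, +oo[%classic.
  apply/seteqP; split => t.
    by move=> [k _ /F_pos]; rewrite /= in_itv /= andbT.
  rewrite /= in_itv /= andbT => t0.
  (* Any [k] with [t <= k + 1] and [1 / t <= k + 1] works. *)
  exists (Num.truncn (Num.max t t^-1)) => //; rewrite /F /= in_itv /=.
  have h := truncnS_gt (Num.max t t^-1).
  apply/andP; split.
    rewrite -[leRHS]invrK lef_pV2 ?posrE ?invr_gt0 // ltW //.
    by apply: le_lt_trans h; rewrite le_max lexx orbT.
  by rewrite ltW //; apply: le_lt_trans h; rewrite le_max lexx.
have int_F k : mu.-integrable (F k) (EFin \o density).
  apply: itv_integrable => [|t]; first by rewrite invr_gt0 ltr0n.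
  exact: density_continuous.
have := @ge0_nondecreasing_set_cvg_integral _ (measurableTypeR R) R F (EFin \o density) mu.
rewrite bigF /=.
have ndF : nondecreasing_seq F.
  apply/nondecreasing_seqP => k; rewrite subsetEset /F.
  apply: subset_itv; rewrite bnd_simp ?ler_nat //.
  by rewrite lef_pV2 ?posrE ?ltr0n ?ler_nat.
move=> /(_ ndF (fun k => measurable_itv _) (fun k => measurable_int mu (int_F k))).
have F_ge0 k t : F k t -> (0 <= (EFin \o density) t)%E.
  by move=> _; rewrite lee_fin density_ge0.
move=> /(_ F_ge0); set I := (X in _ --> X) => cvgF.
have massE k : (\int[mu]_(t in F k) (density t)%:E = (mass k.+1%:R^-1 k.+1%:R)%:E)%E.
  by rewrite fineK //; apply: integrable_fin_num => //; exact: int_F.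
have I_le : (I <= 9%:E)%E.
  have /cvg_lim <- // := cvgF.
  apply: lime_le; first by apply/cvg_ex; exists I.
  apply: nearW => k; rewrite massE lee_fin; apply: mass_bounded => //.
    by rewrite invf_le1 // ler1n.
  by rewrite ler1n.
have I_ge0 : (0 <= I)%E by apply: integral_ge0 => t _; rewrite lee_fin density_ge0.
have I_fin : I \is a fin_num by rewrite ge0_fin_numE // (le_lt_trans I_le) ?ltry.
move: cvgF; rewrite -(fineK I_fin) => /fine_cvg.
by under eq_fun do rewrite /= massE.
Qed.

End sinpi2_integral.

(** * Comparing sums over all integers with the integral *)

Lemma norm_chain {R : realType} (c s w x v d1 d2 d3 : R) :
  `|s - c * w| <= d1 - d2 -> `|x - c * v| <= d2 - d3 ->
  `|s + x - c * (v + w)| <= d1 - d3.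
Proof. by rewrite !ler_norml => /andP[? ?] /andP[? ?]; apply/andP; split; lra. Qed.

Lemma norm_split {R : realType} (c h m t s1 s2 n e E : R) :
  0 <= c * h <= E -> 0 <= c * t -> 0 <= s1 <= n -> `|s2 - c * m| <= e ->
  `|s1 + s2 - c * (h + (m + t))| <= n + e + E + c * t.
Proof.
rewrite !ler_norml => /andP[? ?] ? /andP[? ?] /andP[? ?].
by apply/andP; split; lra.
Qed.

Section riemann_sum.
Context {R : realType}.
Implicit Types (K a b : R) (m n N M : nat).

(** The value [n H / b^(3/2)] of the argument of [sinc], for [K = n H] and
[m = b]. *)
Definition node K m : R := K * m%:R `^ (- (3 / 2)).

Lemma node_gt0 K m : 0 < K -> (0 < m)%N -> 0 < node K m.
Proof. by move=> K0 m0; rewrite mulr_gt0 ?powR_gt0 ?ltr0n. Qed.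

Lemma node_ge0 K m : 0 < K -> 0 <= node K m.
Proof. by move=> K0; rewrite mulr_ge0 ?powR_ge0 // ltW. Qed.

Lemma node_le K m n : 0 < K -> (0 < m)%N -> (m <= n)%N -> node K n <= node K m.
Proof.
move=> K0 m0 mn; rewrite /node ler_pM2l // ler_powRn ?ltr0n ?ler_nat //; lra.
Qed.

(** Linear in [m]: consecutive nodes bound intervals of equal mass for
[t^(- 5/3) dt]. *)
Lemma node_powR K m : 0 < K -> node K m `^ (- (2 / 3)) = K `^ (- (2 / 3)) * m%:R.
Proof.
move=> K0; rewrite powRM ?powR_ge0 ?(ltW K0) // -powRrM.
by rewrite (_ : - (3 / 2) * - (2 / 3) = 1) ?powRr1 //; field.
Qed.

(** [mass_step] between consecutive nodes, multiplied by [2/3 K^(2/3)]. *)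
Lemma node_step K m : 0 < K -> (0 < m)%N ->
  `| sinpi2 (node K m) - 2 / 3 * K `^ (2 / 3) * mass (node K m.+1) (node K m) | <=
  node K m - node K m.+1.
Proof.
move=> K0 m0; have P0 : 0 < K `^ (2 / 3) by exact: powR_gt0.
have := mass_step _ _ (node_gt0 _ m.+1 K0 isT) (node_le _ _ _ K0 m0 (leqnSn m)).
have -> : node K m.+1 `^ (- (2 / 3)) - node K m `^ (- (2 / 3)) = K `^ (- (2 / 3)).
  by rewrite !node_powR // -natr1; ring.
rewrite powRN; set P := K `^ (2 / 3) in P0 *; set W := mass _ _.
set S := sinpi2 _; set D := _ - _ => h.
have -> : S - 2 / 3 * P * W = - (2 / 3 * P * (W - S * (3 / 2 * P^-1))).
  by field; rewrite gt_eqF.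
have c0 : 0 < 2 / 3 * P by rewrite mulr_gt0 //; lra.
rewrite normrN normrM (gtr0_norm c0); rewrite -(ler_pM2l c0) in h.
apply: le_trans h _.
by rewrite le_eqVlt; apply/orP; left; apply/eqP; field; rewrite gt_eqF.
Qed.

Lemma node_sum K N j : 0 < K -> (0 < N)%N ->
  `| \sum_(N <= m < N + j) sinpi2 (node K m) -
     2 / 3 * K `^ (2 / 3) * mass (node K (N + j)) (node K N) | <=
  node K N - node K (N + j).
Proof.
move=> K0 N0; elim: j => [|j IH].
  by rewrite addn0 big_geq // /mass set_itv1 Rintegral_set1 mulr0 !subrr normr0.
rewrite addnS big_nat_recr ?leq_addr //=.
have Nj0 : (0 < N + j)%N by rewrite addn_gt0 N0.
rewrite (mass_cat _ (node K (N + j))) ?node_gt0 ?node_le ?leq_addr //.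
exact: norm_chain IH (node_step _ _ K0 Nj0).
Qed.

(** The interval is cut at the nodes of index [M + 1] and [N]. The sum from [N]
to [M] matches the middle piece; the terms before [N] are bounded by their
number, and the two outer pieces by their masses. *)
Lemma partial_sum_mass K M N a b : 0 < K -> (0 < N <= M.+1)%N ->
  0 < a -> a <= node K M.+1 -> node K 1 <= b ->
  `| \sum_(1 <= m < M.+1) sinpi2 (node K m) - 2 / 3 * K `^ (2 / 3) * mass a b | <=
  N.-1%:R + (node K N - node K M.+1) +
  5 * (K `^ (4 / 5) * M.+1%:R `^ (- (1 / 5))) +
  2 / 3 * K `^ (2 / 3) * mass (node K N) b.
Proof.
move=> K0 /andP[N0 NM] a0 aM b1.
have P0 : 0 < K `^ (2 / 3) by exact: powR_gt0.
have bN : node K N <= b by apply: le_trans b1; exact: node_le.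
have MN : node K M.+1 <= node K N by exact: node_le.
rewrite (mass_cat _ (node K M.+1)) ?(le_trans MN) //.
rewrite (mass_cat (node K M.+1) (node K N)) ?node_gt0 //.
rewrite (@big_cat_nat _ _ _ N) //=.
have := node_sum K N (M.+1 - N) K0 N0; rewrite subnKC //.
have head : 2 / 3 * K `^ (2 / 3) * mass a (node K M.+1) <=
    5 * (K `^ (4 / 5) * M.+1%:R `^ (- (1 / 5))).
  have -> : 5 * (K `^ (4 / 5) * M.+1%:R `^ (- (1 / 5))) =
      2 / 3 * K `^ (2 / 3) * (15 / 2 * node K M.+1 `^ (2 / 15)).
    rewrite /node powRM ?powR_ge0 ?(ltW K0) // -powRrM.
    rewrite (_ : 4 / 5 = 2 / 3 + 2 / 15); last lra.
    rewrite (_ : - (3 / 2) * (2 / 15) = - (1 / 5)); last lra.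
    by rewrite powRDp //; field.
  by rewrite ler_wpM2l ?mass_head // mulr_ge0 ?ltW //; lra.
have headge : 0 <= 2 / 3 * K `^ (2 / 3) * mass a (node K M.+1).
  by rewrite !mulr_ge0 ?mass_ge0 ?powR_ge0 //; lra.
have tailge : 0 <= 2 / 3 * K `^ (2 / 3) * mass (node K N) b.
  by rewrite !mulr_ge0 ?mass_ge0 ?powR_ge0 //; lra.
have sumge : 0 <= \sum_(1 <= m < N) sinpi2 (node K m).
  by apply: sumr_ge0 => m _; exact: sinpi2_ge0.
have sumle : \sum_(1 <= m < N) sinpi2 (node K m) <= N.-1%:R.
  apply: (@le_trans _ _ (\sum_(1 <= m < N) 1)).
    by apply: ler_sum_nat => m _; exact: sinpi2_le1.
  by rewrite sumr_const_nat subn1.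
by apply: norm_split; rewrite ?head ?headge ?tailge ?sumge ?sumle.
Qed.

(** For [K <= 1] take [N = 1]: the factor [K^(2/3)] already makes the outer
masses small. For [K > 1] take [N] about [sqrt K], so that the number of
discarded terms, their mass and the node [K N^(-3/2)] are all [O(sqrt K)]. *)
Lemma partial_sum_mass_le K M a b : 0 < K ->
  0 < a -> a <= 1 -> 1 <= b -> a <= node K M.+1 -> node K 1 <= b ->
  `| \sum_(1 <= m < M.+1) sinpi2 (node K m) - 2 / 3 * K `^ (2 / 3) * mass a b | <=
  7 * (K `^ (1 / 2) + K `^ (4 / 5) * M.+1%:R `^ (- (1 / 5))).
Proof.
move=> K0 a0 a1 b1 aM bK.
set E := K `^ (4 / 5) * _; have E0 : 0 <= E by rewrite mulr_ge0 ?powR_ge0.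
have s0 : 0 < K `^ (1 / 2) by exact: powR_gt0.
have P0 : 0 < K `^ (2 / 3) by exact: powR_gt0.
have [K1|K1] := leP K 1.
  have := partial_sum_mass K M 1 a b K0 isT a0 aM bK; rewrite -/E.
  have K0' : 0 < K <= 1 by rewrite K0.
  have Ks : K <= K `^ (1 / 2) by apply: ger1_powR => //; lra.
  have Ps : K `^ (2 / 3) <= K `^ (1 / 2) by apply: ger_powR => //; lra.
  have n1 : node K 1 = K by rewrite /node powR1 mulr1.
  have nM := node_ge0 K M.+1 K0.
  have mb : mass (node K 1) b <= 9.
    apply: le_trans (mass_bounded _ _ a0 a1 b1).
    by rewrite [leRHS](mass_cat _ (node K 1)) ?lerDr ?mass_ge0 // (le_trans aM) // node_le.
  have tl : 2 / 3 * K `^ (2 / 3) * mass (node K 1) b <= 6 * K `^ (2 / 3).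
    by rewrite (_ : 6 * _ = 2 / 3 * K `^ (2 / 3) * 9) ?ler_wpM2l ?mulr_ge0 ?(ltW P0) //; lra.
  move=> /le_trans; apply; rewrite n1 in tl *.
  move: tl E0 nM Ks Ps; move: (2 / 3 * _ * mass _ _) (node K M.+1) => x y /=; lra.
have [n [n0 nM nodeN n1 n2]] : exists n, [/\ (0 < n)%N, (n <= M.+1)%N,
    node K n - node K M.+1 <= K `^ (1 / 2),
    n.-1%:R <= K `^ (1 / 2) & n%:R <= 2 * K `^ (1 / 2)].
  have S1 : 1 <= K `^ (1 / 2) by rewrite -[leLHS](powRr0 K) ler_powR ?(ltW K1) //; lra.
  have tr := truncnS_gt (K `^ (1 / 2)).
  have tle : (Num.truncn (K `^ (1 / 2)))%:R <= K `^ (1 / 2).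
    by rewrite truncn_le // ltW.
  (* When [M + 1] is the smaller of the two, the middle sum is empty and the
     node of index [M + 1] need not be small. *)
  exists (minn (Num.truncn (K `^ (1 / 2))).+1 M.+1); split.
  - by rewrite leq_min.
  - exact: geq_minr.
  - have [tM|Mt] := leqP (Num.truncn (K `^ (1 / 2))).+1 M.+1; last first.
      by rewrite subrr ltW.
    apply: (@le_trans _ _ (node K (Num.truncn (K `^ (1 / 2))).+1)).
      by rewrite gerBl node_ge0.
    apply: (@le_trans _ _ (K * (K `^ (1 / 2)) `^ (- (3 / 2)))).
      by rewrite /node ler_pM2l // ler_powRn // ltW.
    rewrite -powRrM -{1}(powRr1 (ltW K0)) -powRDp // ler_powR ?(ltW K1) //; lra.
  - by apply: le_trans tle; rewrite ler_nat -subn1 leq_subLR geq_min add1n leqnn.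
  - apply: (@le_trans _ _ (Num.truncn (K `^ (1 / 2))).+1%:R).
      by rewrite ler_nat geq_minl.
    by rewrite -natr1; lra.
have n0M : (0 < n <= M.+1)%N by rewrite n0.
have := partial_sum_mass K M n a b K0 n0M a0 aM bK; rewrite -/E => /le_trans; apply.
have tl : 2 / 3 * K `^ (2 / 3) * mass (node K n) b <= n%:R.
  apply: (@le_trans _ _ (2 / 3 * K `^ (2 / 3) * (3 / 2 * node K n `^ (- (2 / 3))))).
    rewrite ler_wpM2l ?mass_tail ?node_gt0 //; first by rewrite mulr_ge0 // ltW.
    by apply: le_trans bK; exact: node_le.
  rewrite node_powR // powRN le_eqVlt; apply/orP; left; apply/eqP.
  by field; rewrite gt_eqF.
move: tl nodeN n1 n2 E0; move: (_ * mass _ _) (_ - _) => x y; lra.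
Qed.
End riemann_sum.

(** * Restricting the sum to squarefree integers *)

Lemma cvg_dist_le {R : realType} (u v : nat -> R) (l m e : R) :
  u @ \oo --> l -> v @ \oo --> m -> (\forall n \near \oo, `|u n - v n| <= e) ->
  `|l - m| <= e.
Proof.
move=> ul vm uv.
have h : (fun n => `|u n - v n|) @ \oo --> `|l - m|.
  by apply: cvg_norm; apply: cvgB.
rewrite -(cvg_lim (@Rhausdorff R) h); apply: limr_le => //.
by apply/cvg_ex; exists `|l - m|.
Qed.

Section squarefree.
Context {R : realType}.
Implicit Types (K : R) (d m n M B : nat).

Definition total_mass : R :=
  \int[@lebesgue_measure R]_(y in `]0, +oo[) (sinc y ^+ 2 * y `^ (1 / 3)).

Lemma total_mass_bounds : 0 <= total_mass <= 9.
Proof.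
apply/andP; split.
  by apply: Rintegral_ge0 => t _; rewrite mulr_ge0 ?sqr_ge0 ?powR_ge0.
rewrite /total_mass -(cvg_lim (@Rhausdorff R) (@mass_cvg R)); apply: limr_le.
  by apply/cvg_ex; exists total_mass; exact: mass_cvg.
by apply: nearW => k; apply: mass_bounded; rewrite ?invr_gt0 ?invf_le1 ?ler1n ?ltr0n.
Qed.

Lemma partial_sum_integral K M : 0 < K ->
  `| \sum_(1 <= m < M.+1) sinpi2 (node K m) - 2 / 3 * K `^ (2 / 3) * total_mass | <=
  7 * (K `^ (1 / 2) + K `^ (4 / 5) * M.+1%:R `^ (- (1 / 5))).
Proof.
move=> K0; have y0 := node_gt0 K M.+1 K0 isT.
set S := \sum_(_ <= _ < _) _; set c := 2 / 3 * _.
apply: (@cvg_dist_le _ (fun=> S) (fun k => c * mass k.+1%:R^-1 k.+1%:R)).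
- exact: cvg_cst.
- by apply: cvgM; [exact: cvg_cst|exact: mass_cvg].
near=> k; apply: partial_sum_mass_le => //.
- by rewrite invf_le1 ?ler1n ?ltr0n.
- by rewrite ler1n.
- rewrite -[leRHS]invrK lef_pV2 ?posrE ?invr_gt0 ?ltr0n //.
  by rewrite -natr1 ler_wpDr //; near: k; exact: nbhs_infty_ger.
- by rewrite -natr1 ler_wpDr //; near: k; exact: nbhs_infty_ger.
Unshelve. all: by end_near. Qed.

Definition squarefree_sum B K : R :=
  \sum_(1 <= b < B.+1) (mobius b)%:~R ^+ 2 * sinpi2 (node K b).

Lemma node_sqr_mul K d m : node K (d ^ 2 * m) = node (K * d%:R `^ (- 3)) m.
Proof.
rewrite /node natrM natrX powRM ?exprn_ge0 // mulrA; congr (_ * _ * _).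
by rewrite -powR_mulrn // -powRrM; congr (_ `^ _); field.
Qed.

Lemma squarefree_sum_mobius B K :
  squarefree_sum B K = \sum_(1 <= d < B.+1) (mobius d)%:~R *
    \sum_(1 <= m < (B %/ d ^ 2).+1) sinpi2 (node (K * d%:R `^ (- 3)) m).
Proof.
transitivity (\sum_(1 <= d < B.+1) (mobius d)%:~R *
    \sum_(1 <= m < (B %/ d ^ 2).+1) sinpi2 (node K (d ^ 2 * m))); last first.
  apply: eq_bigr => d _; congr (_ * _); apply: eq_bigr => m _.
  by rewrite node_sqr_mul.
rewrite -(sum_mobius_interchange (fun b => sinpi2 (node K b))) //.
apply: eq_big_nat => b b1B; rewrite sum_mobius_square_divisors //.
by rewrite rmorphXn.
Qed.

(** The error of [partial_sum_integral] for [K / d^3] and [B / d^2] is at most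
[K^(1/2) d^(-3/2) + K^(4/5) (B + 1)^(-1/5) d^(-2)], which is summable in [d]:
the rounding of [B / d^2] is harmless because its successor is at
least [(B + 1) / d^2], even when [d^2 > B] and the sum over [m] is empty. *)
Lemma squarefree_sum_approx B K : 0 < K ->
  `| squarefree_sum B K -
     2 / 3 * K `^ (2 / 3) * total_mass *
       \sum_(1 <= d < B.+1) (mobius d)%:~R * d%:R `^ (- 2) | <=
  21 * (K `^ (1 / 2) + K `^ (4 / 5) * B.+1%:R `^ (- (1 / 5))).
Proof.
move=> K0; rewrite squarefree_sum_mobius mulr_sumr -sumrB.
apply: le_trans (ler_norm_sum _ _ _) _.
apply: (@le_trans _ _ (\sum_(1 <= d < B.+1)
    (7 * K `^ (1 / 2) * d%:R `^ (- (1 + 1 / 2)) +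
     7 * (K `^ (4 / 5) * B.+1%:R `^ (- (1 / 5))) * d%:R `^ (- (1 + 1))))).
  apply: ler_sum_nat => d /andP[d0 dB].
  have D0 : 0 < d%:R :> R by rewrite ltr0n.
  have Kd0 : 0 < K * d%:R `^ (- 3) by rewrite mulr_gt0 ?powR_gt0.
  rewrite mulrCA -mulrBr normrM -[leRHS]mul1r; apply: ler_pM => //.
    exact: norm_mobius.
  have -> : 2 / 3 * K `^ (2 / 3) * total_mass * d%:R `^ (- 2) =
      2 / 3 * (K * d%:R `^ (- 3)) `^ (2 / 3) * total_mass.
    rewrite powRM ?powR_ge0 ?(ltW K0) // -powRrM.
    rewrite (_ : - 3 * (2 / 3) = - 2); last by field.
    by rewrite mulrA mulrAC.
  apply: le_trans (partial_sum_integral _ _ Kd0) _.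
  rewrite !powRM ?powR_ge0 ?(ltW K0) // -!powRrM mulrDr; apply: lerD.
    by rewrite mulrA ler_wpM2l ?mulr_ge0 ?powR_ge0 // (_ : - 3 * (1 / 2) = - (1 + 1 / 2)) //; field.
  have le1 : B.+1%:R * d%:R `^ (- 2) <= (B %/ d ^ 2).+1%:R :> R.
    rewrite powR_invn // ler_pdivrMr ?exprn_gt0 // -natrX -natrM ler_nat.
    by rewrite ltn_ceil // expn_gt0 d0.
  rewrite -!mulrA ler_pM2l // ler_pM2l ?powR_gt0 //.
  apply: (@le_trans _ _ (d%:R `^ (- 3 * (4 / 5)) * (B.+1%:R * d%:R `^ (- 2)) `^ (- (1 / 5)))).
    rewrite ler_wpM2l ?powR_ge0 // ler_powRn //.
    by rewrite mulr_gt0 ?powR_gt0 ?ltr0n.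
  rewrite powRM ?powR_ge0 // -powRrM mulrCA -powRDp //.
  by rewrite ler_wpM2l ?powR_ge0 // (_ : - 3 * (4 / 5) + _ = - (1 + 1)) //; field.
rewrite big_split /= -!mulr_sumr.
have h12 : 0 < 1 / 2 :> R by lra.
set x := K `^ (1 / 2); set y := K `^ (4 / 5) * _.
rewrite (_ : 21 * (x + y) = 7 * x * 3 + 7 * y * 3); last by ring.
apply: lerD; rewrite ler_wpM2l ?mulr_ge0 ?powR_ge0 //.
  by apply: le_trans (sum_powR_le _ _ h12) _; rewrite le_eqVlt; apply/orP; left; apply/eqP; field.
by apply: le_trans (sum_powR_le _ _ ltr01) _; rewrite invr1; lra.
Qed.

Lemma squarefree_sum_zeta B K : 0 < K -> (0 < B)%N ->
  `| squarefree_sum B K - 2 / 3 * K `^ (2 / 3) * total_mass / zeta 2 | <=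
  21 * (K `^ (1 / 2) + K `^ (4 / 5) * B.+1%:R `^ (- (1 / 5))) +
  36 * (K `^ (2 / 3) * B.+1%:R `^ (- (1 / 2))).
Proof.
move=> K0 B0; have /andP[I0 I9] := total_mass_bounds.
have := squarefree_sum_approx B K K0; have := @sum_mobius_inv_sqr R B B0.
set S := \sum_(_ <= _ < _) _; set c := 2 / 3 * _ * _ => hS hQ.
have -> : squarefree_sum B K - c / zeta 2 =
  (squarefree_sum B K - c * S) + c * (S - (zeta 2)^-1) by ring.
apply: le_trans (ler_normD _ _) (lerD hQ _).
have c0 : 0 <= c by rewrite !mulr_ge0 ?powR_ge0 //; lra.
have c6 : c <= 6 * K `^ (2 / 3).
  rewrite (_ : 6 * _ = 2 / 3 * K `^ (2 / 3) * 9); last by field.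
  by rewrite ler_wpM2l // mulr_ge0 ?powR_ge0 //; lra.
rewrite normrM (ger0_norm c0).
rewrite (_ : 36 * _ = 6 * K `^ (2 / 3) * (6 * B.+1%:R `^ (- (1 / 2)))); last by ring.
exact: ler_pM.
Qed.
End squarefree.

(** * Summation over the multiples of H *)

Section sum_over_n.
Context {R : realType}.
Implicit Types (H X : R) (n b B N : nat).

Lemma sinc_sqr (y : R) : 0 < y -> sinc y ^+ 2 = sinpi2 y / y ^+ 2.
Proof.
by move=> y0; rewrite /sinc gt_eqF // /sinpi2 invfM -exprVn; ring.
Qed.

Lemma sinc_node H n b : 0 < H -> (0 < n)%N -> (0 < b)%N ->
  H ^+ 2 * (sinc (n%:R * H / b%:R `^ (3 / 2)) ^+ 2 / b%:R ^+ 3) =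
  n%:R `^ (- 2) * sinpi2 (node (n%:R * H) b).
Proof.
move=> H0 n0 b0.
have N0 : 0 < n%:R :> R by rewrite ltr0n.
have B0 : 0 < b%:R :> R by rewrite ltr0n.
have b3 : (b%:R `^ (3 / 2)) ^+ 2 = b%:R ^+ 3 :> R.
  rewrite -!powR_mulrn ?powR_ge0 ?(ltW B0) // -powRrM.
  by congr (_ `^ _); field.
rewrite sinc_sqr; last by rewrite divr_gt0 ?mulr_gt0 ?powR_gt0.
rewrite /node powR_invn ?(ltW N0) // powRN expr_div_n b3.
by field; rewrite !gt_eqF.
Qed.

(** The terms are bounded by a multiple of [n^(-2)]. *)
Lemma sinc_sum_cvg H b : 0 < H -> (0 < b)%N ->
  (fun N => \sum_(1 <= n < N) sinc (n%:R * H / b%:R `^ (3 / 2)) ^+ 2) @ \oo -->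
  \big[+%R/0]_(1 <= n <oo) sinc (n%:R * H / b%:R `^ (3 / 2)) ^+ 2.
Proof.
move=> H0 b0; apply: nondecreasing_is_cvgn.
  apply/nondecreasing_seqP => n; case: n => [|n]; first by rewrite !big_geq.
  by rewrite [X in _ <= X]big_nat_recr //= lerDl sqr_ge0.
have b_gt0 : 0 < b%:R :> R by rewrite ltr0n.
have B3 : 0 < b%:R ^+ 3 :> R by rewrite exprn_gt0.
have H2 : 0 < H ^+ 2 by rewrite exprn_gt0.
exists (b%:R ^+ 3 / H ^+ 2 * 2) => _ [N _ <-].
apply: (@le_trans _ _ (\sum_(1 <= n < N) b%:R ^+ 3 / H ^+ 2 * n%:R `^ (- (1 + 1)))).
  apply: ler_sum_nat => n /andP[n0 _].
  have -> : sinc (n%:R * H / b%:R `^ (3 / 2)) ^+ 2 =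
      b%:R ^+ 3 / H ^+ 2 * (n%:R `^ (- 2) * sinpi2 (node (n%:R * H) b)).
    by rewrite -sinc_node //; field; rewrite !gt_eqF.
  rewrite ler_pM2l ?divr_gt0 // -[leRHS]mulr1.
  by rewrite (_ : - (1 + 1) = - 2) ?ler_wpM2l ?powR_ge0 ?sinpi2_le1.
rewrite -mulr_sumr ler_pM2l ?divr_gt0 //.
by apply: le_trans (sum_powR_le _ _ ltr01) _; rewrite invr1; lra.
Qed.

Lemma sinc_partial_sum H B N : 0 < H ->
  2 * H ^+ 2 * (\sum_(1 <= b < B.+1) ((mobius b)%:~R ^+ 2 / b%:R ^+ 3 *
     \sum_(1 <= n < N) sinc (n%:R * H / b%:R `^ (3 / 2)) ^+ 2)) =
  2 * \sum_(1 <= n < N) n%:R `^ (- 2) * squarefree_sum B (n%:R * H).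
Proof.
move=> H0; rewrite -mulrA; congr (_ * _); rewrite mulr_sumr.
under eq_bigr => b _ do rewrite mulrA mulr_sumr.
rewrite exchange_big_nat /=; apply: eq_big_nat => n /andP[n0 _].
rewrite mulr_sumr; apply: eq_big_nat => b /andP[b0 _].
by rewrite [RHS]mulrCA -sinc_node //; ring.
Qed.

Lemma squarefree_partial_sum H B N : 0 < H -> (0 < B)%N ->
  `| 2 * \sum_(1 <= n < N) n%:R `^ (- 2) * squarefree_sum B (n%:R * H) -
     H `^ (2 / 3) * (4 * (\sum_(1 <= n < N) n%:R `^ (- (4 / 3))) / (3 * zeta 2)) *
     total_mass | <=
  666 * (H `^ (1 / 2) + H `^ (4 / 5) * B.+1%:R `^ (- (1 / 5)) +
         H `^ (2 / 3) * B.+1%:R `^ (- (1 / 2))).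
Proof.
move=> H0 B0; have z1 : 1 <= zeta 2 :> R by apply: zeta_ge1; lra.
have z0 : zeta 2 != 0 :> R by rewrite gt_eqF // (lt_le_trans ltr01).
set x := H `^ (1 / 2); set y := H `^ (4 / 5) * _; set z := H `^ (2 / 3) * B.+1%:R `^ _.
have -> : H `^ (2 / 3) * (4 * (\sum_(1 <= n < N) n%:R `^ (- (4 / 3))) / (3 * zeta 2)) *
    total_mass = 2 * \sum_(1 <= n < N) n%:R `^ (- 2) *
      (2 / 3 * (n%:R * H) `^ (2 / 3) * total_mass / zeta 2).
  transitivity (2 * ((2 / 3 * H `^ (2 / 3) * total_mass / zeta 2) *
      \sum_(1 <= n < N) n%:R `^ (- (4 / 3)))); first by field.
  congr (_ * _); rewrite mulr_sumr; apply: eq_big_nat => n /andP[n0 _].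
  have N0 : 0 < n%:R :> R by rewrite ltr0n.
  rewrite powRM ?(ltW N0) ?(ltW H0) // (_ : - (4 / 3) = - 2 + 2 / 3); last by field.
  by rewrite powRDp //; field.
rewrite -mulrBr -sumrB normrM ger0_norm //.
apply: (@le_trans _ _ (2 * \sum_(1 <= n < N)
   (21 * x * n%:R `^ (- (1 + 1 / 2)) + 21 * y * n%:R `^ (- (1 + 1 / 5)) +
    36 * z * n%:R `^ (- (1 + 1 / 3))))).
  rewrite ler_pM2l //; apply: le_trans (ler_norm_sum _ _ _) _.
  apply: ler_sum_nat => n /andP[n0 _].
  have N0 : 0 < n%:R :> R by rewrite ltr0n.
  have nH0 : 0 < n%:R * H by rewrite mulr_gt0.
  rewrite -mulrBr normrM (ger0_norm (powR_ge0 _ _)).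
  apply: le_trans (ler_wpM2l (powR_ge0 _ _) (squarefree_sum_zeta B _ nH0 B0)) _.
  rewrite !powRM ?(ltW N0) ?(ltW H0) //.
  rewrite (_ : - (1 + 1 / 2) = - 2 + 1 / 2); last by field.
  rewrite (_ : - (1 + 1 / 5) = - 2 + 4 / 5); last by field.
  rewrite (_ : - (1 + 1 / 3) = - 2 + 2 / 3); last by field.
  rewrite !(powRDp (n%:R)) // /x /y /z le_eqVlt; apply/orP; left; apply/eqP; ring.
rewrite !big_split /= -!mulr_sumr.
have x0 : 0 <= x by exact: powR_ge0.
have y0 : 0 <= y by rewrite mulr_ge0 ?powR_ge0.
have z0' : 0 <= z by rewrite mulr_ge0 ?powR_ge0.
have sum_le (t : R) (k : R) : 0 < t -> 1 + t^-1 <= k ->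
    \sum_(1 <= n < N) n%:R `^ (- (1 + t)) <= k.
  by move=> t0; apply: le_trans; exact: sum_powR_le.
have hx : \sum_(1 <= n < N) n%:R `^ (- (1 + 1 / 2)) <= 3 :> R.
  by apply: sum_le; [lra|rewrite div1r invrK; lra].
have hy : \sum_(1 <= n < N) n%:R `^ (- (1 + 1 / 5)) <= 6 :> R.
  by apply: sum_le; [lra|rewrite div1r invrK; lra].
have hz : \sum_(1 <= n < N) n%:R `^ (- (1 + 1 / 3)) <= 4 :> R.
  by apply: sum_le; [lra|rewrite div1r invrK; lra].
(* [3], [6] and [4] are the bounds [1 + 1/t] for [t = 1/2], [1/5] and [1/3]. *)
apply: (@le_trans _ _ (2 * (21 * x * 3 + 21 * y * 6 + 36 * z * 4))); last lra.
rewrite ler_pM2l //; apply: lerD; last by rewrite ler_wpM2l ?mulr_ge0 ?powR_ge0.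
by apply: lerD; rewrite ler_wpM2l ?mulr_ge0 ?powR_ge0.
Qed.

(** The left-hand side equals [a^(2/5) b^(3/5)], where [a] and [b] are the two terms
on the right: the contributions of [eps] cancel. *)
Lemma error_interpolation H X eps : 1 <= H -> 0 < X ->
  H `^ (4 / 5) * X `^ (- (1 / 20)) <=
  H `^ (1 + eps / 4) / X `^ (1 / 8) + H `^ (2 / 3 - eps / 6).
Proof.
move=> H1 X0; have H0 : 0 < H by exact: lt_le_trans H1.
set a := H `^ _ / _; set b := H `^ (2 / 3 - _).
have a0 : 0 < a by rewrite divr_gt0 ?powR_gt0.
have b0 : 0 < b by rewrite powR_gt0.
have -> : H `^ (4 / 5) * X `^ (- (1 / 20)) = a `^ (2 / 5) * b `^ (3 / 5).
  rewrite /a /b -powRN powRM ?powR_ge0 // -!powRrM mulrAC -powRDp //.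
  by congr (_ `^ _ * _ `^ _); field.
have split (m : R) : 0 < m -> m = m `^ (2 / 5) * m `^ (3 / 5).
  by move=> m0; rewrite -powRDp // (_ : 2 / 5 + 3 / 5 = 1) ?powRr1 ?ltW //; field.
have [ab|/ltW ba] := leP a b.
  apply: (@le_trans _ _ b); last by rewrite lerDr ltW.
  by rewrite [leRHS]split // ler_wpM2r ?powR_ge0 // ge0_ler_powR ?nnegrE ?(ltW a0) ?(ltW b0) //; lra.
apply: (@le_trans _ _ a); last by rewrite lerDl ltW.
by rewrite [leRHS]split // ler_wpM2l ?powR_ge0 // ge0_ler_powR ?nnegrE ?(ltW a0) ?(ltW b0) //; lra.
Qed.
End sum_over_n.

Theorem proposition2 (R : realType) (eps : R) (eps_gt0 : 0 < eps)
    (eps_lt : eps < 1 / 10) :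
  exists C : R, 0 < C /\
    forall X H : R, 0 <= X -> 1 <= H -> H <= X `^ (1 / 2) ->
    `| 2 * H ^+ 2 *
         (\sum_(1 <= b < (Num.truncn (X `^ (1 / 4))).+1)
            ((mobius b)%:~R ^+ 2 / b%:R ^+ 3 *
             \big[+%R/0]_(1 <= n <oo) sinc (n%:R * H / b%:R `^ (3 / 2)) ^+ 2))
       - H `^ (2 / 3) * (4 * zeta (4 / 3) / (3 * zeta 2)) *
           (\int[@lebesgue_measure R]_(y in `]0, +oo[) (sinc y ^+ 2 * y `^ (1 / 3))) |
    <= C * (H `^ (1 + eps / 4) / X `^ (1 / 8) + H `^ (2 / 3 - eps / 6)).
Proof.
(* [666] is the constant of [squarefree_partial_sum]; each of its three error
   terms is at most the sum of the two allowed ones. *)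
exists (666 * 3); split; first by rewrite mulr_gt0 ?ltr0n.
move=> X H X_ge0 H1 HX.
have H0 : 0 < H by exact: lt_le_trans H1.
have X0 : 0 < X.
  rewrite lt_neqAle X_ge0 andbT; apply: contraTneq HX => <-.
  by rewrite powR0 ?leNgt ?negbK // gt_eqF //; lra.
have X1 : 1 <= X `^ (1 / 4).
  have := le_trans H1 HX; rewrite !powR_exp // -!expR0 !ler_expR; lra.
set B := Num.truncn _.
have B0 : (0 < B)%N by rewrite truncn_gt0.
have XB : X `^ (1 / 4) <= B.+1%:R by rewrite ltW // truncnS_gt.
have XB0 : 0 < X `^ (1 / 4) by exact: powR_gt0.
set a := H `^ (1 + _) / _; set b := H `^ (2 / 3 - _).
have ea : H `^ (4 / 5) * B.+1%:R `^ (- (1 / 5)) <= a + b.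
  apply: le_trans (error_interpolation _ _ eps H1 X0).
  rewrite ler_wpM2l ?powR_ge0 //.
  rewrite (_ : - (1 / 20) = 1 / 4 * - (1 / 5)); last by field.
  by rewrite powRrM ler_powRn.
have eb : H `^ (1 / 2) <= a + b.
  apply: (@le_trans _ _ b).
    by rewrite ler_powR //; lra.
  by rewrite lerDr divr_ge0 ?powR_ge0.
(* Absorbed by the term of [ea], since [H] and [B + 1] are at least [1]. *)
have ec : H `^ (2 / 3) * B.+1%:R `^ (- (1 / 2)) <= a + b.
  apply: le_trans ea; apply: ler_pM; rewrite ?powR_ge0 //; rewrite ler_powR ?ler1n //; lra.
apply: (@le_trans _ _ (666 * (H `^ (1 / 2) + H `^ (4 / 5) * B.+1%:R `^ (- (1 / 5)) +
         H `^ (2 / 3) * B.+1%:R `^ (- (1 / 2))))); last lra.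
apply: (@cvg_dist_le _
  (fun N => 2 * H ^+ 2 * (\sum_(1 <= b < B.+1) ((mobius b)%:~R ^+ 2 / b%:R ^+ 3 *
     \sum_(1 <= n < N) sinc (n%:R * H / b%:R `^ (3 / 2)) ^+ 2)))
  (fun N => H `^ (2 / 3) * (4 * (\sum_(1 <= n < N) n%:R `^ (- (4 / 3))) / (3 * zeta 2)) *
     total_mass)).
- apply: cvgM; first exact: cvg_cst.
  rewrite big_nat_cond; under eq_fun do rewrite big_nat_cond.
  apply: cvg_big => [|c /andP[/andP[c0 _] _]]; first exact: add_continuous.
  by apply: cvgM; [exact: cvg_cst|exact: sinc_sum_cvg].
- apply: cvgM; last exact: cvg_cst.
  apply: cvgM; first exact: cvg_cst.
  apply: cvgM; last exact: cvg_cst.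
  apply: cvgM; first exact: cvg_cst.
  by apply: zeta_cvg; lra.
- by apply: nearW => N; rewrite sinc_partial_sum // squarefree_partial_sum.
Qed.
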